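(* Let $n\ge 3$. The $n\times n$ matrix $$B_{n} = \begin{pmatrix} 0 & 1 & 2 & 4 & 8 & \cdots & 2^{n-2} \\ 1 & 0 & 1 & 2 & 4 & \cdots & 2^{n-3} \\ 0 & 1 & 0 & 1 & 2 & \cdots & 2^{n-4} \\ 0 & 0 & 1 & 0 & 1 & \cdots & 2^{n-5} \\ 0 & 0 & 0 & 1 & 0 & \cdots & 2^{n-6} \\ \vdots & \vdots & \vdots & \vdots & \vdots & \ddots & \vdots \\ 0 & 0 & 0 & 0 & 0 & \cdots & 0 \end{pmatrix}$$ (whose $(p,q)$ entry is $2^{q-p-1}$ if $q>p$, $0$ if $q=p$, $1$ if $q=p-1$, and $0$ if $q<p-1$) is a production matrix for non-crossing partitions of point sets in convex position; that is, $v^{i+1}=B_n v^i$ for all $i\ge 1$ with $i+2\le n$.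
   Context: A partition of $[i]=\{1,\dots,i\}$ into nonempty, pairwise disjoint blocks is non-crossing if whenever $1\le a<b<c<d\le i$ are such that $a,c$ are in the same block and $b,d$ are in the same block, the two blocks coincide. A non-crossing partition is drawn as a plane geometric graph on points $p_1,\dots,p_i$ in convex position labelled in counter-clockwise order: each block with at least three elements is drawn as the convex polygon (cycle) through its points, a block of size two as the edge joining its two points, and a block of size one as an isolated vertex. Two vertices are visible (from each other) if the line segment connecting them does not intersect the interior of any edge of the graph. The isolation degree of the root vertex $p_i$ is the number of isolated vertices (singleton blocks) that are visible from an additional vertex $p_{i+1}$ inserted between $p_i$ and $p_1$ in convex position; it is between $0$ and $i$. For $1\le i\le n-1$, $v^i$ is the $n$-dimensional column vector whose $j$-th entry is the number of non-crossing partitions with $i$ vertices whose root vertex has isolation degree $j-1$ (so $v^1=(0,1,0,\dots,0)^\top$). A production matrix is a matrix satisfying $v^{i+1}=B_nv^i$. *)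

(* Defs.v *)
From HB Require Import structures.
From mathcomp Require Import all_boot all_order all_algebra.
From mathcomp Require Import boolp.

Set Implicit Arguments.
Unset Strict Implicit.
Unset Printing Implicit Defensive.

Import Order.TTheory GRing.Theory Num.Theory.
Local Open Scope ring_scope.

(* Indices are 0-based throughout: the vertices of a partition of size i are
   the ordinals of 'I_i, a configuration p : 'I_i.+1 -> 'rV[R]_2 places vertex
   x at p (widen_ord _ x), and p ord_max is the additional point, inserted
   between the root (the last vertex) and the first vertex. *)

Section Plane.
Variable R : realFieldType.
Implicit Types x y z : 'rV[R]_2.

Definition segment x y z : Prop :=
  exists t : R, [/\ 0 <= t, t <= 1 & z = (1 - t) *: x + t *: y].

Definition open_segment x y z : Prop :=
  exists t : R, [/\ 0 < t, t < 1 & z = (1 - t) *: x + t *: y].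

(* Twice the signed area of the triangle x y z; it is positive if and only if
   the triangle is non-degenerate and traversed counter-clockwise. *)
Definition orient x y z : R :=
  (y 0 0 - x 0 0) * (z 0 1 - x 0 1) - (y 0 1 - x 0 1) * (z 0 0 - x 0 0).

(* Injectivity only matters for m = 2, where there are no triples. *)
Definition ccw_convex_position m (p : 'I_m -> 'rV[R]_2) : Prop :=
  injective p /\
  forall a b c : 'I_m, (a < b)%N -> (b < c)%N -> 0 < orient (p a) (p b) (p c).

End Plane.

Definition noncrossing i (P : {set {set 'I_i}}) : bool :=
  partition P [set: 'I_i] &&
  [forall a : 'I_i, forall b : 'I_i, forall c : 'I_i, forall d : 'I_i,
   forall A in P, forall B in P,
     [&& (a < b)%N, (b < c)%N, (c < d)%N, a \in A, c \in A, b \in B & d \in B]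
     ==> (A == B)].

(* enum A lists A in increasing order, so next (enum A) is the cyclic successor
   in A.  A block of size at least 3 yields the sides of its polygon, a block
   {x, y} yields (x, y) and (y, x), which are the same segment, and a singleton
   yields nothing. *)
Definition edges i (P : {set {set 'I_i}}) : {set 'I_i * 'I_i} :=
  [set e | [exists A in P,
     [&& e.1 \in A, e.2 == next (enum A) e.1 & e.1 != e.2]]].

Section Visibility.
Variables (R : realFieldType) (i : nat) (p : 'I_i.+1 -> 'rV[R]_2).

Definition vertex (x : 'I_i) : 'rV[R]_2 := p (widen_ord (leqnSn i) x).

Definition visible (P : {set {set 'I_i}}) (x y : 'rV[R]_2) : Prop :=
  forall e, e \in edges P ->
    ~ exists z, segment x y z /\ open_segment (vertex e.1) (vertex e.2) z.

Definition isolation_degree (P : {set {set 'I_i}}) : nat :=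
  #|[set x : 'I_i | ([set x] \in P) && `[< visible P (vertex x) (p ord_max) >]]|.

Definition degree_vector n : 'cV[int]_n :=
  \col_(j < n)
    (#|[set P : {set {set 'I_i}} |
        noncrossing P && (isolation_degree P == j)]|)%:Z.

End Visibility.

Definition production_mx n : 'M[int]_n :=
  \matrix_(r < n, c < n)
    if (r < c)%N then 2 ^+ (c - r - 1) else (r == c.+1 :> nat)%:Z.

(* Main.v *)
(** An isolated vertex is visible from the additional point exactly when no
    block of the partition contains vertices on both sides of it; call such a
    singleton exposed.  From a non-crossing partition [P] of [i] vertices and a
    set [S] of exposed singletons, form a partition of [i + 1] vertices by
    merging the singletons of [S] with the new root into one block.  This is a
    bijection onto all non-crossing partitions of [i + 1] vertices: the inverse
    breaks the block of the root into singletons and forgets the root.  If [S]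
    is empty then all the exposed singletons survive and the root is a further
    one; otherwise exactly those before [min S] survive.  So of the [2 ^ c]
    choices of [S] for a [P] of degree [c], one leads to degree [c + 1] and
    [2 ^ (c - r - 1)] lead to degree [r], for each [r < c]. *)

Require Import Defs.
From mathcomp Require Import all_boot all_order all_algebra.
From mathcomp Require Import boolp zify ring lra.
Set Implicit Arguments.
Unset Strict Implicit.
Unset Printing Implicit Defensive.
Import Order.TTheory GRing.Theory Num.Theory.

(** * Partitions as equivalence relations *)

Definition same (T : finType) (P : {set {set T}}) : rel T :=
  fun x y => y \in pblock P x.

(** Inverse to [same]: partitions are built and compared through relations, so that set equalities
    reduce to pointwise ones. *)
Definition quot (T : finType) (r : rel T) : {set {set T}} :=
  equivalence_partition r [set: T].

Lemma same_equiv (T : finType) (P : {set {set T}}) :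
  partition P setT -> equivalence_rel (same P).
Proof.
move=> pP x y z; have cP := cover_partition pP; have tP := partition_trivIset pP.
rewrite /same mem_pblock cP; split=> // xy.
by rewrite -!eq_pblock ?cP // in xy *; rewrite (eqP xy).
Qed.

Lemma same_refl (T : finType) (P : {set {set T}}) :
  partition P setT -> reflexive (same P).
Proof. by move=> pP x; rewrite /same mem_pblock (cover_partition pP). Qed.

Lemma same_sym (T : finType) (P : {set {set T}}) :
  partition P setT -> symmetric (same P).
Proof.
move=> /same_equiv eP.
have sub u v : same P u v -> same P v u.
  by move=> uv; rewrite -((eP u v u).2 uv) (eP u u u).1.
by move=> x y; apply/idP/idP; apply: sub.
Qed.

Lemma same_trans (T : finType) (P : {set {set T}}) :
  partition P setT -> transitive (same P).
Proof. by move=> /same_equiv eP y x z xy; rewrite ((eP x y z).2 xy). Qed.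

Lemma same_quot (T : finType) (r : rel T) :
  equivalence_rel r -> same (quot r) =2 r.
Proof.
by move=> er x y; rewrite /same /quot pblock_equivalence_partition //; apply: in3W.
Qed.

Lemma partition_quot (T : finType) (r : rel T) :
  equivalence_rel r -> partition (quot r) setT.
Proof. by move=> er; apply: equivalence_partitionP; apply: in3W. Qed.

Lemma eq_quot (T : finType) (r s : rel T) : r =2 s -> quot r = quot s.
Proof.
move=> rs; by apply: eq_imset => x; apply/setP=> y; rewrite !inE rs.
Qed.

Lemma quot_same (T : finType) (P : {set {set T}}) :
  partition P setT -> quot (same P) = P.
Proof. exact: equivalence_partition_pblock. Qed.

Lemma same_blockP (T : finType) (P : {set {set T}}) (x y : T) :
  partition P setT ->
  reflect (exists A, [/\ A \in P, x \in A & y \in A]) (same P x y).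
Proof.
move=> pP; have cP := cover_partition pP; have tP := partition_trivIset pP.
apply: (iffP idP) => [xy|[A [AP xA yA]]]; last by rewrite /same (def_pblock tP AP).
by exists (pblock P x); split; rewrite ?pblock_mem ?mem_pblock ?cP.
Qed.

Lemma set1_in_partition (T : finType) (P : {set {set T}}) (x : T) :
  partition P setT -> ([set x] \in P) = [forall y, same P x y ==> (y == x)].
Proof.
move=> pP; have cP := cover_partition pP; have tP := partition_trivIset pP.
apply/idP/forallP => [xP y|xP].
  by apply/implyP; rewrite /same (def_pblock tP xP) ?inE.
suff <- : pblock P x = [set x] by rewrite pblock_mem ?cP.
apply/setP=> y; rewrite inE; apply/idP/eqP => [xy|->].
  by apply/eqP; apply: (implyP (xP y)).
by rewrite mem_pblock cP.
Qed.

(** * Non-crossing and exposure in relational form *)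

Lemma noncrossingP i (P : {set {set 'I_i}}) :
  reflect (partition P setT /\ forall a b c d : 'I_i, a < b -> b < c -> c < d ->
            same P a c -> same P b d -> same P a b)
          (noncrossing P).
Proof.
apply: (iffP andP) => -[pP nc]; split=> //.
  move=> a b c d ab bc cd.
  move=> /(same_blockP _ _ pP)[A [AP aA cA]] /(same_blockP _ _ pP)[B [BP bB dB]].
  move: nc => /forallP/(_ a)/forallP/(_ b)/forallP/(_ c)/forallP/(_ d).
  move=> /forall_inP/(_ _ AP)/forall_inP/(_ _ BP)/implyP AB.
  apply/(same_blockP _ _ pP); exists A; split=> //.
  by rewrite (eqP (AB _)) // ab bc cd aA cA bB dB.
have tP := partition_trivIset pP.
do 4!apply/forallP=> ?; apply/forall_inP=> A AP; apply/forall_inP=> B BP.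
apply/implyP=> /and5P[ab bc cd aA /and3P[cA bB dB]].
have := nc _ _ _ _ ab bc cd; rewrite /same.
rewrite (def_pblock tP AP aA) (def_pblock tP BP bB) => /(_ cA dB) bA.
by rewrite -(def_pblock tP AP bA) (def_pblock tP BP bB).
Qed.

(** Combinatorial counterpart of visibility; [isolation_degreeE] makes the link with the plane
    drawing. *)
Definition exposed i (P : {set {set 'I_i}}) : {set 'I_i} :=
  [set x | ([set x] \in P) &&
    [forall a : 'I_i, forall b : 'I_i, (a < x < b) ==> ~~ same P a b]].

Lemma exposedP i (P : {set {set 'I_i}}) (x : 'I_i) : partition P setT ->
  reflect ((forall y, same P x y -> y = x) /\
           forall a b : 'I_i, a < x -> x < b -> ~~ same P a b)
          (x \in exposed P).
Proof.
move=> pP; rewrite inE set1_in_partition //.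
apply: (iffP andP) => -[xP xe]; split.
- by move=> y xy; apply/eqP; apply: (implyP (forallP xP y)).
- move=> a b ax xb; move/forallP: xe => /(_ a)/forallP/(_ b)/implyP; apply.
  by rewrite ax.
- by apply/forallP=> y; apply/implyP=> /xP ->.
- by apply/forallP=> a; apply/forallP=> b; apply/implyP=> /andP[]; apply: xe.
Qed.

(** * Adding and removing the root: the bijection *)

Section Extension.
Variable i : nat.
Implicit Types (P : {set {set 'I_i}}) (S : {set 'I_i}).
Implicit Types (Q : {set {set 'I_i.+1}}).

Notation lft := (lift (@ord_max i)).

Definition join_last (r : rel 'I_i) S : rel 'I_i.+1 := fun x y =>
  match unlift ord_max x, unlift ord_max y with
  | Some a, Some b => r a b || (a \in S) && (b \in S)
  | Some a, None | None, Some a => a \in S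
  | None, None => true
  end.

(** The disjunct [x == y] turns the partners of the root into singletons. Testing [x] alone against
    the root suffices, since [x] and [y] are related. *)
Definition drop_last (r : rel 'I_i.+1) : rel 'I_i := fun x y =>
  (x == y) || r (lft x) (lft y) && ~~ r ord_max (lft x).

Definition extend P S := quot (join_last (same P) S).
Definition shrink Q := quot (drop_last (same Q)).
Definition partners Q := [set x | same Q ord_max (lft x)].
(** For [E = exposed P], the old singletons still exposed once [S] joins the root; all of [E] when
    [S] is empty. *)
Definition below (E S : {set 'I_i}) :=
  [set x in E | [forall s in S, x < s]].

(** Members of [S] are singletons of [P], so membership in [S] is constant on classes ([SP]);
    transitivity follows. *)
Lemma join_last_equiv P S : partition P setT -> S \subset exposed P ->
  equivalence_rel (join_last (same P) S).
Proof.
move=> pP /subsetP SE; have eP := same_equiv pP.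
have S1 x y : x \in S -> same P x y -> y = x.
  by move=> /SE/(exposedP _ pP)[+ _]; apply.
have rP := same_refl pP.
have SP a b : same P a b -> (a \in S) = (b \in S).
  move=> ab; apply/idP/idP => h; first by rewrite (S1 _ _ h ab).
  by rewrite (S1 b a) // same_sym.
move=> x y z; rewrite /join_last.
case: (unliftP ord_max x) => [a _|_]; case: (unliftP ord_max y) => [b _|_];
  case: (unliftP ord_max z) => [c _|_]; split; rewrite ?rP //.
- move=> /orP[ab|/andP[aS bS]]; first by rewrite ((eP a b c).2 ab) (SP _ _ ab).
  rewrite aS bS /=; apply/orP/orP => -[] h; try by right.
    by right; rewrite (S1 _ _ aS h).
  by right; rewrite (S1 _ _ bS h).
- by move=> /orP[/SP|/andP[-> ->]].
- move=> aS; rewrite aS; apply/orP/idP => [[/(S1 _ _ aS) ->|]|] //; by right.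
- move=> bS; rewrite bS; apply/idP/orP => [|[/(S1 _ _ bS) ->|]] //; by right.
Qed.

Lemma same_extend P S : partition P setT -> S \subset exposed P ->
  same (extend P S) =2 join_last (same P) S.
Proof. by move=> pP SE; apply/same_quot/join_last_equiv. Qed.

Lemma extend_partition P S : partition P setT -> S \subset exposed P ->
  partition (extend P S) setT.
Proof. by move=> pP SE; apply/partition_quot/join_last_equiv. Qed.

Lemma drop_last_equiv Q : partition Q setT -> equivalence_rel (drop_last (same Q)).
Proof.
move=> pQ; have eQ := same_equiv pQ.
have sC := same_sym pQ.
move=> x y z; rewrite /drop_last eqxx; split=> //.
case: (eqVneq x y) => [-> //|xy /= /andP[rxy nx]].
have ny : ~~ same Q ord_max (lft y).
  by apply: contra nx => my; apply: (same_trans pQ my); rewrite sC.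
rewrite ((eQ (lft x) (lft y) (lft z)).2 rxy) nx ny !andbT.
case: eqVneq => [<-|_]; first by rewrite sC rxy !orbT.
by rewrite orFb; case: (eqVneq y z) => [->|_]; rewrite ?same_refl.
Qed.

Lemma same_shrink Q : partition Q setT -> same (shrink Q) =2 drop_last (same Q).
Proof. by move=> pQ; apply/same_quot/drop_last_equiv. Qed.

Lemma extend_noncrossing P S : noncrossing P -> S \subset exposed P ->
  noncrossing (extend P S).
Proof.
move=> /noncrossingP[pP nc] SE; apply/noncrossingP.
split=> [|a b c d ab bc cd]; first exact: extend_partition.
have no (x : 'I_i) : (i < x) = false by rewrite ltnNge ltnW.
have Scov x : x \in S ->
    forall a b : 'I_i, a < x -> x < b -> same P a b -> False.
  by move=> /(subsetP SE)/(exposedP _ pP)[_ h] u v ux xv; apply/negP/h.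
rewrite !same_extend // /join_last.
case: (unliftP ord_max a) ab => [{}a ->|->];
  case: (unliftP ord_max b) bc => [{}b ->|->];
  case: (unliftP ord_max c) cd => [{}c ->|->];
  case: (unliftP ord_max d) => [{}d ->|->];
  rewrite ?lift_max ?[nat_of_ord ord_max]/= ?no ?ltnn //.
(* Only [d] can be the root. When just one of the two ties is new, a point of [S] lies strictly
   between two points of an old block, against exposure. *)
- move=> cd bc ab /orP[ac|/andP[aS cS]] /orP[bd|/andP[bS dS]].
  + by rewrite (nc a b c d).
  + by case: (Scov b bS _ _ ab bc ac).
  + by case: (Scov c cS _ _ bc cd bd).
  + by rewrite aS bS orbT.
- move=> _ bc ab /orP[ac|/andP[aS cS]] bS; last by rewrite aS bS orbT.
  by case: (Scov b bS _ _ ab bc ac).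
Qed.

Lemma shrink_noncrossing Q : noncrossing Q -> noncrossing (shrink Q).
Proof.
move=> /noncrossingP[pQ nc]; apply/noncrossingP.
split=> [|a b c d ab bc cd]; first exact/partition_quot/drop_last_equiv.
rewrite !same_shrink // /drop_last.
have -> : (a == c) = false by apply/eqP=> ac; move: ab bc; rewrite ac; lia.
have -> : (b == d) = false by apply/eqP=> ac; move: bc cd; rewrite ac; lia.
move=> /= /andP[ac an] /andP[bd bn]; rewrite an andbT orbC.
by rewrite (nc _ _ (lft c) (lft d)) // !lift_max.
Qed.

(** A tie from [a] to [b] around a partner [x] would cross the tie from [x] to the root, so [a]
    would lie in the root's block, which [shrink] has dissolved. *)
Lemma partners_exposed Q : noncrossing Q -> partners Q \subset exposed (shrink Q).
Proof.
move=> /noncrossingP[pQ nc]; apply/subsetP=> x; rewrite inE => mx.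
apply/exposedP; first exact/partition_quot/drop_last_equiv.
split=> [y|a b ax xb]; rewrite same_shrink // /drop_last.
  by rewrite mx andbF orbF => /eqP.
have -> : (a == b) = false by apply/eqP=> ac; move: ax xb; rewrite ac; lia.
apply/negP=> /= /andP[ab /negP]; apply.
rewrite same_sym // (same_trans pQ (y := lft x)) //; last by rewrite same_sym.
by apply: (nc _ _ (lft b) ord_max); rewrite ?lift_max // same_sym.
Qed.

(** A tie of [Q] inside the root's block is restored by the partners; any other tie survives in
    [shrink Q]. *)
Lemma shrinkK Q : noncrossing Q -> extend (shrink Q) (partners Q) = Q.
Proof.
move=> /noncrossingP[pQ nc]; rewrite -[RHS]quot_same //; apply: eq_quot => x y.
have rQ := same_refl pQ.
have sQ := same_sym pQ; have tQ := same_trans pQ.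
rewrite /join_last.
case: unliftP => [a ->|->]; case: unliftP => [b ->|->]; rewrite ?rQ ?inE //.
rewrite same_shrink // /drop_last.
case: eqVneq => [->|_] /=; first by rewrite rQ.
apply/orP/idP => [[/andP[]//|/andP[am bm]]|ab].
  by apply: (tQ ord_max) => //; rewrite sQ.
case: (boolP (same Q ord_max (lft a))) => am; last by left; rewrite ab.
by right; rewrite (tQ _ _ _ am ab).
Qed.

Lemma extendK P S : partition P setT -> S \subset exposed P ->
  shrink (extend P S) = P.
Proof.
move=> pP SE; rewrite -[RHS]quot_same //; apply: eq_quot => x y.
rewrite /drop_last !same_extend // /join_last unlift_none !liftK.
case: eqVneq => [->|xy] /=; first by rewrite same_refl.
case: (boolP (x \in S)) => xS; rewrite ?andbF ?andbT ?orbF //.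
apply/esym/negP=> /((exposedP _ pP (subsetP SE _ xS)).1 _) yx.
by rewrite yx eqxx in xy.
Qed.

Lemma partners_extend P S : partition P setT -> S \subset exposed P ->
  partners (extend P S) = S.
Proof.
move=> pP SE; apply/setP=> x.
by rewrite inE same_extend // /join_last unlift_none liftK.
Qed.

Lemma card_exposed_extend P S : noncrossing P -> S \subset exposed P ->
  #|exposed (extend P S)| = (S == set0) + #|below (exposed P) S|.
Proof.
move=> /noncrossingP[pP nc] SE; have pQ := extend_partition pP SE.
have memL (x : 'I_i) :
    (lft x \in exposed (extend P S)) = (x \in below (exposed P) S).
  rewrite [RHS]inE; apply/exposedP/andP => //
    [[x1 xe]|[/(exposedP _ pP)[x1 xe] /forall_inP xS]].
    have xS : x \notin S.
      apply/negP=> xS; have := x1 ord_max.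
      rewrite same_extend // /join_last unlift_none liftK xS => /(_ isT) h.
      by have := neq_lift ord_max x; rewrite -h eqxx.
    split.
      apply/exposedP=> //; split=> [y xy|a b ax xb].
        apply: (@lift_inj _ ord_max); apply: x1.
        by rewrite same_extend // /join_last !liftK xy.
      have := xe (lft a) (lft b); rewrite !lift_max => /(_ ax xb).
      by rewrite same_extend // /join_last !liftK negb_or => /andP[].
    apply/forall_inP=> s sS; rewrite ltnNge leq_eqVlt; apply/norP; split.
      by apply: contra xS => /eqP/val_inj <-.
    apply/negP=> sx; have := xe (lft s) ord_max; rewrite !lift_max => /(_ sx).
    by rewrite same_extend // /join_last unlift_none liftK sS /= ltn_ord => /(_ isT).
  have xNS : x \notin S by apply/negP=> /xS; rewrite ltnn.
  split=> [y|a b].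
    rewrite same_extend // /join_last liftK; case: (unliftP ord_max y) => [b ->|_].
      by rewrite (negPf xNS) orbF => /x1 ->.
    by rewrite (negPf xNS).
  rewrite same_extend // /join_last.
  case: (unliftP ord_max a) => [{}a ->|->]; rewrite ?lift_max /= => ax; last first.
    by have := ltn_ord x; lia.
  (* All of [S] lies after [x], so a tie starting before [x] must be an old one. *)
  have aNS : a \notin S by apply/negP=> /xS; lia.
  case: (unliftP ord_max b) => [{}b ->|->];
    rewrite ?lift_max ?(negPf aNS) //= orbF.
  exact: xe.
have memM : (ord_max \in exposed (extend P S)) = (S == set0).
  apply/exposedP/eqP => // [[x1 _]|S0].
    apply/setP=> y; rewrite inE; apply/negP=> yS.
    have := x1 (lft y); rewrite same_extend // /join_last unlift_none liftK.
    move=> /(_ yS) h.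
    by have := neq_lift ord_max y; rewrite h eqxx.
  split=> [y|a b].
    case: (unliftP ord_max y) => [b ->|-> //].
    by rewrite same_extend // /join_last unlift_none liftK S0 inE.
  by rewrite /= [i < b]ltnNge leq_ord.
rewrite -sum1_card big_mkcond big_ord_recr /= memM addnC.
congr (_ + _).
rewrite -sum1_card [RHS]big_mkcond; apply: eq_bigr => x _; rewrite -memL.
by have -> : widen_ord (leqnSn i) x = lft x by apply: val_inj; rewrite [RHS]lift_max.
Qed.
End Extension.

(** * Counting the choices of [S] *)

(** The minimum of [S] must be the element of [E] with exactly [r] elements of [E] before it, and
    the later ones are free. The induction on [r] removes the minimum [m] of [E]. *)
Lemma card_nonempty_below i (E : {set 'I_i}) r :
  #|[set S : {set 'I_i} |
      [&& S \subset E, S != set0 & #|below E S| == r]]| =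
  if r < #|E| then 2 ^ (#|E| - r - 1) else 0.
Proof.
elim: r E => [|r IH] E; have [->|[m0 m0E]] := set_0Vmem E.
(* These are the goals with [E] empty. *)
1,3: by rewrite cards0 ltn0; apply: eq_card0 => S; rewrite !inE subset0; case: eqP.
all: have [m mE mmin] := arg_minnP (fun j : 'I_i => j : nat) m0E.
all: have {}mE : m \in E := mE.
all: have {}mmin (j : 'I_i) : j \in E -> m <= j := mmin j.
all: have cE : #|E| = #|E :\ m|.+1 by rewrite (cardsD1 m) mE.
  rewrite cE /= subn0 subn1 /= -card_powerset.
  (* For [r = 0] the set must contain [m], and the rest is any subset of [E :\ m]. *)
  pose f S := m |: S.
  rewrite -(card_in_imset (f := f) (D := powerset (E :\ m))); last first.
    move=> S S'; rewrite !inE !subsetD1 => /andP[_ mS] /andP[_ mS']; rewrite /f => h.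
    by rewrite -(setU1K mS) h setU1K.
  apply: eq_card => S; rewrite !inE; apply/and3P/imsetP => [[SE S0]|[S']].
    rewrite cards_eq0 => /eqP b0; have mS : m \in S.
      apply: contraT => mS; have : m \in below E S.
        rewrite inE mE; apply/forall_inP=> s sS.
        rewrite ltn_neqAle mmin ?(subsetP SE) // andbT.
        by apply: contraNneq mS => /val_inj ->.
      by rewrite b0 inE.
    exists (S :\ m); last by rewrite /f setD1K.
    by rewrite inE setSD.
  rewrite inE subsetD1 => /andP[SE mS] ->; split.
  - by rewrite subUset sub1set mE.
  - by apply/set0Pn; exists m; rewrite setU11.
  - rewrite cards_eq0; apply/eqP/setP=> x; rewrite !inE; apply/negP=> /andP[xE].
    by move=> /forall_inP/(_ m); rewrite setU11 ltnNge mmin // => /(_ isT).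
(* For a positive count [m] is not in [S], since otherwise nothing is below [S]; then [m] itself
   contributes one. *)
rewrite cE ltnS subSS -IH; apply: eq_card => S; rewrite !inE subsetD1.
case: (boolP (S \subset E)) => //= SE; case: (boolP (m \in S)) => mS /=.
  have -> : below E S = set0; last by rewrite cards0 andbF.
  apply/setP=> x; rewrite !inE; apply/negP=> /andP[xE /forall_inP/(_ m mS)].
  by rewrite ltnNge mmin.
congr (_ && _).
have -> : below E S = m |: below (E :\ m) S.
  apply/setP=> x; rewrite !inE; case: (eqVneq x m) => [->|] //=.
  rewrite mE /=; apply/forall_inP=> s sS.
  rewrite ltn_neqAle mmin ?(subsetP SE) // andbT.
  by apply: contraNneq mS => /val_inj ->.
by rewrite cardsU1 !inE eqxx.
Qed.

Lemma card_below i (E : {set 'I_i}) r :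
  #|[set S : {set 'I_i} |
      (S \subset E) && ((S == set0) + #|below E S| == r)]| =
  if r < #|E| then 2 ^ (#|E| - r - 1) else (r == #|E|.+1).
Proof.
have below0 : below E set0 = E.
  apply/setP=> x; rewrite inE; case: (x \in E) => //=.
  by apply/forall_inP=> s; rewrite inE.
rewrite (cardsD1 set0) inE sub0set eqxx below0 add1n /=.
(* The two cases exclude each other, so they add up: the first summand counts the empty set, the
   second the non-empty ones. Both vanish at [r = #|E|], the zero diagonal of the matrix. *)
have -> : (if r < #|E| then 2 ^ (#|E| - r - 1) else (r == #|E|.+1) : nat) =
  (r == #|E|.+1) + (if r < #|E| then 2 ^ (#|E| - r - 1) else 0).
  by case: ltnP => [rE|]; rewrite ?addn0 // ltn_eqF // ltnW.
rewrite -card_nonempty_below eq_sym; congr (_ + _).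
apply: eq_card => S; rewrite !inE.
by case: eqP; rewrite ?andbF ?andbT.
Qed.

(** * Edges of the drawing and blocks *)

Lemma edges_same i (P : {set {set 'I_i}}) e : partition P setT ->
  e \in edges P -> same P e.1 e.2.
Proof.
move=> pP; rewrite inE => /exists_inP[A AP /and3P[e1 /eqP e2 _]].
apply/(same_blockP _ _ pP); exists A; split=> //.
by rewrite e2 -mem_enum mem_next mem_enum.
Qed.

(* The edges of a block form a cycle, so running along it from [a] to [b] some
   edge has to jump over [x]. *)
Lemma edge_across i (P : {set {set 'I_i}}) (a x b : 'I_i) : partition P setT ->
  [set x] \in P -> (a < x < b) -> same P a b ->
  exists2 e, e \in edges P & e.1 < x < e.2.
Proof.
move=> pP xP /andP[ax xb] /(same_blockP _ _ pP)[A [AP aA bA]].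
have xA : x \notin A.
  apply/negP=> xA; have tP := partition_trivIset pP.
  have := aA; rewrite -(def_pblock tP AP xA) (def_pblock tP xP) ?inE // => /eqP ae.
  by rewrite ae ltnn in ax.
apply: contrapT => none.
suff h k : iter k (next (enum A)) a \in A /\ (iter k (next (enum A)) a < x).
  have ab : fconnect (next (enum A)) a b.
    by rewrite (fconnect_cycle (cycle_next (enum_uniq _))) mem_enum.
  by have [_] := h (findex (next (enum A)) a b); rewrite iter_findex // ltnNge ltnW.
elim: k => [//|k /= []]; set c := iter k _ a => cA cx.
have nA : next (enum A) c \in A by rewrite -mem_enum mem_next mem_enum.
split=> //; rewrite ltnNge; apply/negP=> xn; apply: none.
have xn' : (x < next (enum A) c).
  by rewrite ltn_neqAle xn andbT; apply: contraNneq xA => /val_inj ->.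
exists (c, next (enum A) c); last by rewrite cx.
rewrite inE; apply/exists_inP; exists A => //=.
rewrite cA eqxx /=; apply/eqP=> cn.
by move: xn'; rewrite -cn ltnNge ltnW.
Qed.

(** * The recursion for the counts *)

Lemma card_noncrossing_exposed i r :
  #|[set Q : {set {set 'I_i.+1}} | noncrossing Q && (#|exposed Q| == r)]| =
  \sum_(P : {set {set 'I_i}} | noncrossing P)
    (if r < #|exposed P| then 2 ^ (#|exposed P| - r - 1)
     else r == #|exposed P|.+1).
Proof.
(* Each summand becomes a count of sets [S], so the right side counts pairs [(P, S)], which [extend]
   maps bijectively onto the left side. *)
under eq_bigr => P _ do rewrite -card_below -sum1dep_card.
rewrite pair_big_dep /= sum1dep_card; set D := (X in _ = #|X|).
have inD P S : (P, S) \in D ->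
    [/\ noncrossing P, S \subset exposed P
      & (S == set0) + #|below (exposed P) S| == r].
  by rewrite inE => /and3P.
pose f (u : {set {set 'I_i}} * {set 'I_i}) := extend u.1 u.2.
rewrite -(card_in_imset (f := f) (D := D)); last first.
  move=> [P S] [P' S'] /inD[/noncrossingP[nP _] SE _].
  move=> /inD[/noncrossingP[nP' _] SE' _]; rewrite /f /= => e.
  congr (_, _); first by rewrite -(extendK nP SE) e extendK.
  by rewrite -(partners_extend nP SE) e partners_extend.
apply: eq_card => Q; rewrite inE.
apply/andP/imsetP => [[nQ Qr]|[[P S] /inD[nP SE Sr] ->]].
  exists (shrink Q, partners Q); last by rewrite /f /= shrinkK.
  rewrite inE /= shrink_noncrossing // partners_exposed //=.
  by rewrite -card_exposed_extend ?shrinkK ?shrink_noncrossing ?partners_exposed.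
by rewrite /f /= extend_noncrossing // card_exposed_extend.
Qed.

Local Open Scope ring_scope.

(** * Visibility in convex position *)

Section Geometry.
Variable R : realFieldType.
Implicit Types a b x y z m : 'rV[R]_2.

Lemma orient_affine a b x y t :
  orient a b ((1 - t) *: x + t *: y) = (1 - t) * orient a b x + t * orient a b y.
Proof. by rewrite /orient !mxE; ring. Qed.

Lemma orient_cycle a b x : orient a b x = orient x a b.
Proof. by rewrite /orient; ring. Qed.

Lemma open_segmentC x y z : open_segment x y z -> open_segment y x z.
Proof.
move=> [t [t0 t1 ->]]; exists (1 - t); split; [lra|lra|].
by rewrite subKr addrC.
Qed.

(** The affine function [orient a b] vanishes on the line through [a] and [b] but is positive on the
    whole segment from [x] to [m]. *)
Lemma segment_disjoint a b x m z : 0 < orient a b x -> 0 < orient a b m ->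
  segment x m z -> ~ open_segment a b z.
Proof.
move=> ox om [t [t0 t1 ->]] [s [s0 s1 /(congr1 (orient a b))]].
rewrite !orient_affine.
have -> : orient a b a = 0 by rewrite /orient; ring.
have -> : orient a b b = 0 by rewrite /orient; ring.
have := mulr_ge0 t0 (ltW om).
have : 0 <= (1 - t) * orient a b x by apply: mulr_ge0 (ltW ox); lra.
have [->|tn] := eqVneq t 0; first by move=> *; lra.
have : 0 < t * orient a b m by rewrite mulr_gt0 // lt_neqAle eq_sym tn.
move=> *; lra.
Qed.

Lemma diagonals_meet a x b m :
  0 < orient a x b -> 0 < orient a b m -> 0 < orient a x m -> 0 < orient x b m ->
  exists z, segment x m z /\ open_segment a b z.
Proof.
move=> oaxb oabm oaxm oxbm.
(* Twice the area of the quadrilateral [a x b m], cut along either diagonal. The ratios [t] and [s]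
   locate the intersection on each diagonal. *)
pose d := orient a x b + orient a b m.
have d_alt : d = orient a x m + orient x b m by rewrite /d /orient; ring.
have d0 : 0 < d by rewrite addr_gt0.
pose t := orient a x b / d; pose s := orient a x m / d.
exists ((1 - t) *: x + t *: m); split.
  exists t; split=> //; first by rewrite divr_ge0 ?ltW.
  by rewrite ler_pdivrMr // mul1r lerDl ltW.
exists s; split; first by rewrite divr_gt0.
  by rewrite ltr_pdivrMr // mul1r d_alt ltrDl.
apply/rowP=> j; rewrite !mxE.
have dn := lt0r_neq0 d0; rewrite /t /s.
have [->|->] : j = 0 \/ j = 1.
  by case: j => -[|[|//]] ?; [left|right]; apply: val_inj.
  all: move: dn; rewrite /d /orient => dn; field; exact: dn.
Qed.

Variables (i : nat) (p : 'I_i.+1 -> 'rV[R]_2).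
Hypothesis ccw_p : ccw_convex_position p.

(** A block on both sides of [x] has an edge jumping over [x], which meets the line of sight as the
    other diagonal of a convex quadrilateral. An edge not jumping over [x] has [x] and the new point
    strictly on the same side. *)
Lemma visibleP (P : {set {set 'I_i}}) (x : 'I_i) :
  partition P setT -> [set x] \in P ->
  visible p P (vertex p x) (p ord_max) <->
  forall a b : 'I_i, (a < x < b)%N -> ~~ same P a b.
Proof.
move=> pP xP; have [_ ccw] := ccw_p.
have ltm (y : 'I_i) : (widen_ord (leqnSn i) y < @ord_max i)%N := ltn_ord y.
have alone (y : 'I_i) : same P x y -> y = x.
  by move: xP; rewrite set1_in_partition // => /forallP/(_ y)/implyP h /h/eqP.
split=> [vis a b axb|uncov e eP [z [sz oz]]].
  apply/negP=> /(edge_across pP xP axb)[e eP /andP[ex xe]].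
  apply: (vis e eP); apply: diagonals_meet; apply: ccw => //.
  exact: ltn_trans ex xe.
have same_e := edges_same pP eP.
have e1x : e.1 != x :> nat.
  apply/eqP=> /val_inj ex; have ex2 := alone e.2; rewrite ex in same_e.
  move: eP; rewrite inE => /exists_inP[A _ /and3P[_ _]].
  by rewrite ex ex2 ?eqxx.
have e2x : e.2 != x :> nat.
  apply/eqP=> /val_inj ex; rewrite ex same_sym // in same_e.
  by move: e1x; rewrite (alone _ same_e) eqxx.
have apart (a b : 'I_i) : (a < b)%N -> ~~ (a < x < b)%N ->
    a != x :> nat -> b != x :> nat -> ~ open_segment (vertex p a) (vertex p b) z.
  move=> ab nx ax bx; apply: segment_disjoint sz; last exact: ccw.
  case: (ltnP x a) => xa; first by rewrite orient_cycle; apply: ccw.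
  have bltx : (b < x)%N by lia.
  exact: ccw.
have nx1 : ~~ (e.1 < x < e.2)%N by apply/negP=> /uncov; rewrite same_e.
have nx2 : ~~ (e.2 < x < e.1)%N by apply/negP=> /uncov; rewrite same_sym // same_e.
(* Edges follow the cyclic successor, so the closing one runs from a larger to a smaller index. *)
case: (ltngtP e.1 e.2) => e12.
- exact: apart oz.
- by apply: apart (open_segmentC oz).
- move: eP; rewrite inE => /exists_inP[A _ /and3P[_ _]].
  by rewrite (val_inj e12) eqxx.
Qed.

Lemma isolation_degreeE (P : {set {set 'I_i}}) : noncrossing P ->
  isolation_degree p P = #|exposed P|.
Proof.
move=> /noncrossingP[pP _]; apply: eq_card => x; rewrite !inE.
case: (boolP ([set x] \in P)) => //= xP; apply/asboolP/forallP.
  move=> /(visibleP pP xP) h a; apply/forallP=> b; apply/implyP; exact: h.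
move=> h; apply/(visibleP pP xP) => a b; apply/implyP; exact: (forallP (h a)).
Qed.

Lemma degree_vectorE n (r : 'I_n) (c : 'I_1) : degree_vector p n r c =
  #|[set P : {set {set 'I_i}} | noncrossing P && (#|exposed P| == r)]|%:Z.
Proof.
rewrite mxE; congr Posz; apply: eq_card => P; rewrite !inE.
by case: (boolP (noncrossing P)) => //= nP; rewrite isolation_degreeE.
Qed.

End Geometry.

(** * The recursion as a matrix product *)

Theorem theorem15 (R : realFieldType) (n i : nat)
    (p : 'I_i.+1 -> 'rV[R]_2) (q : 'I_i.+2 -> 'rV[R]_2) :
  (3 <= n)%N -> (1 <= i)%N -> (i + 2 <= n)%N ->
  ccw_convex_position p -> ccw_convex_position q ->
  degree_vector q n = production_mx n *m degree_vector p n.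
Proof.
move=> _ _ i2n ccw_p ccw_q; apply/colP=> r.
rewrite degree_vectorE // card_noncrossing_exposed [RHS]mxE.
(* Each entry of the vector is written as a sum of indicators over [P]; after exchanging sums, each
   [P] selects the single column [c = #|exposed P|]. *)
under [RHS]eq_bigr => c _.
  rewrite degree_vectorE // -sum1dep_card big_mkcondr -natz natr_sum mulr_sumr.
  over.
rewrite /= exchange_big -natz natr_sum; apply: eq_bigr => P nP.
(* The degree is at most [i], hence a valid column index. *)
have en : (#|exposed P| < n)%N.
  by have := max_card (exposed P); rewrite card_ord; lia.
rewrite (bigD1 (Ordinal en)) //= eqxx mulr1 big1 ?addr0 => [|c cn]; last first.
  suff -> : (#|exposed P| == c) = false by rewrite mulr0.
  by apply: contraNF cn => /eqP ec; apply/eqP/val_inj.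
rewrite mxE /=; case: ifP => _; first by rewrite natrX.
by case: (_ == _).
Qed.
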